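(* Let $G$ be a finite graph. There is a bijection between the set of totally non-backtracking closed walks in $G$ and the set of (isomorphism classes of) pyramids of loops in $G$, with concurrency relation edge intersection, whose unique maximal piece is additionally equipped with an edge-simple closed walk (starting directed edge and direction) representing its loop. Moreover, if a walk corresponds to a pyramid, then each edge of $G$ is used the same number of times in the walk as in the labels of the pieces of the pyramid (counting over all pieces).
   Context: Closed walks are sequences of directed edges $(\gamma_1,\dots,\gamma_n)$ with head of $\gamma_j$ equal to tail of $\gamma_{j+1}$ (mod $n$), non-backtracking meaning no edge is immediately followed by its reverse (cyclically). Loop erasure step: if no undirected edge occurs twice, stop successfully; otherwise let $k$ be the largest index such that the undirected edge of $\gamma_k$ occurs at exactly one index $m>k$; if $\gamma_m=\gamma_k$ as directed edges remove $(\gamma_k,\dots,\gamma_{m-1})$, otherwise fail. A closed non-backtracking walk is totally non-backtracking if iterated erasure never fails. A loop is an equivalence class of edge-simple closed walks under cyclic shift and reversal. A heap of loops is a finite poset $(P,\preceq)$ with a labelling $\ell$ of its elements (pieces) by loops such that any two pieces whose labels share an edge are comparable, and $\preceq$ is the transitive closure of these comparabilities. A pyramid is a heap with a unique maximal piece. *)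

(* Defs.v *)
From mathcomp Require Import all_boot.
Set Implicit Arguments. Unset Strict Implicit. Unset Printing Implicit Defensive.

(* A finite (multi)graph: finite vertex type V, finite edge type E, and
   [ends e = (u, v)] the two endpoints of edge e (self-loops and multiple
   edges allowed).  A directed edge is a pair (e, b) : E * bool; b = true
   traverses e from (ends e).1 to (ends e).2, b = false the other way. *)

Section Walks.
Variables (V E : finType) (ends : E -> V * V).

Definition dtail (d : E * bool) : V := if d.2 then (ends d.1).1 else (ends d.1).2.
Definition dhead (d : E * bool) : V := if d.2 then (ends d.1).2 else (ends d.1).1.
Definition drev (d : E * bool) : E * bool := (d.1, ~~ d.2).

Definition closed_walk (s : seq (E * bool)) : bool :=
  (s != [::]) && cycle (fun d1 d2 => dhead d1 == dtail d2) s.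

Definition nonbacktracking (s : seq (E * bool)) : bool :=
  cycle (fun d1 d2 => d2 != drev d1) s.

Definition edge_simple (s : seq (E * bool)) : bool := uniq (map fst s).

Definition occ_after (s : seq (E * bool)) (i : nat) : nat :=
  if drop i s is x :: r then count (fun y => y.1 == x.1) r else 0.

(* one loop-erasure step: [Some None] = stop successfully,
   [Some (Some s')] = continue with s', [None] = fail *)
Definition erase_step (s : seq (E * bool)) : option (option (seq (E * bool))) :=
  if edge_simple s then Some None else
  let k := last 0 [seq i <- iota 0 (size s) | occ_after s i == 1] in
  if drop k s is x :: r then
    let j := index x.1 (map fst r) in   (* m = k + 1 + j *)
    if nth x r j == x then Some (Some (take k s ++ drop j r)) else None
  else None.

(* iterated erasure never fails (fuel is sufficient since each step shortens) *)
Fixpoint erase_ok (fuel : nat) (s : seq (E * bool)) : bool :=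
  match fuel with
  | 0 => false
  | fuel'.+1 =>
    match erase_step s with
    | None => false
    | Some None => true
    | Some (Some s') => erase_ok fuel' s'
    end
  end.

Definition totally_nb (s : seq (E * bool)) : bool :=
  [&& closed_walk s, nonbacktracking s & erase_ok (size s).+1 s].

Definition loop_walk (s : seq (E * bool)) : bool :=
  closed_walk s && edge_simple s.

Definition rev_walk (s : seq (E * bool)) : seq (E * bool) := rev (map drev s).

Definition same_loop (s t : seq (E * bool)) : bool :=
  has (fun i => (rot i s == t) || (rot i (rev_walk s) == t)) (iota 0 (size s)).

Definition share_edge (s t : seq (E * bool)) : bool :=
  has (fun d => d.1 \in map fst t) s.

End Walks.

(* A (candidate) heap of loops with a decorated top: pieces 'I_pn, labels
   given by representative edge-simple closed walks (a loop is the
   same_loop-class of its label), order ple, and a decoration pdeco, the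
   edge-simple closed walk attached to the unique maximal piece. *)
Record dpyr (E : finType) := DPyr {
  pn : nat;
  plab : 'I_pn -> seq (E * bool);
  ple : rel 'I_pn;
  pdeco : seq (E * bool) }.
Arguments pn {E} d.
Arguments plab {E} d _.
Arguments ple {E} d _ _.
Arguments pdeco {E} d.

Definition maximal_piece (E : finType) (P : dpyr E) (t : 'I_(pn P)) : Prop :=
  forall q, ple P t q -> q = t.

Definition valid_dpyr (V E : finType) (ends : E -> V * V) (P : dpyr E) : Prop :=
  (forall p, loop_walk ends (plab P p)) /\
  (forall p, ple P p p) /\
  (forall p q, ple P p q -> ple P q p -> p = q) /\
  (forall p q r, ple P p q -> ple P q r -> ple P p r) /\
  (forall p q, share_edge (plab P p) (plab P q) -> ple P p q || ple P q p) /\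
  (forall p q, ple P p q =
     connect (fun a b => ple P a b && share_edge (plab P a) (plab P b)) p q) /\
  (exists t, [/\ maximal_piece (P:=P) t, (forall q, maximal_piece (P:=P) q -> q = t),
                 loop_walk ends (pdeco P) & same_loop (plab P t) (pdeco P)]).

Definition dpyr_iso (E : finType) (P Q : dpyr E) : Prop :=
  exists f : 'I_(pn P) -> 'I_(pn Q),
    [/\ bijective f,
        (forall p q, ple Q (f p) (f q) = ple P p q),
        (forall p, same_loop (plab P p) (plab Q (f p))) &
        pdeco P = pdeco Q].

Definition edge_count (E : finType) (e : E) (s : seq (E * bool)) : nat :=
  count (fun d => d.1 == e) s.

(* Main.v *)
(* Read a walk from its last edge backwards while keeping an edge-simple walk t:
   a new directed edge is put in front of t, and if its undirected edge already
   lies in t (necessarily in the same direction) the loop this closes is popped.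
   This is exactly iterated erasure, the final t is the decorated top piece, and
   a loop popped later lies above an earlier one whenever they share an edge.
   Every popped loop keeps its first edge in t, so it meets a later one: the
   heap is a pyramid. Non-backtracking is automatic, since d in front of its
   reverse makes the erasure fail.
   Conversely, let t = d :: u be the current walk and H the remaining heap.
   The step that processed d popped a loop iff some maximal piece of H contains
   the edge of d and is disjoint from u; all pieces containing that edge are
   comparable, so this piece, rooted at d, is determined and the walk can be
   read off the pyramid. *)
Require Import Defs.
From mathcomp Require Import all_boot.
Set Implicit Arguments. Unset Strict Implicit. Unset Printing Implicit Defensive.

(** * Loop erasure as a fold from the last directed edge *)

Section LoopErasure.
Variable E : finType.
Local Notation dart := (E * bool)%type.
Local Notation edges s := (map fst s).
Implicit Types (d : dart) (s t w : seq dart) (Ls : seq (seq dart)).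

(** The state consists of the popped loops, latest first, and the current walk. [None] records the
    clash of a directed edge with its reverse. *)
Definition erase_dart d (st : seq (seq dart) * seq dart) :=
  let: (Ls, t) := st in
  if d.1 \notin edges t then Some (Ls, d :: t) else
  let j := index d.1 (edges t) in
  if nth d t j == d then Some ((d :: take j t) :: Ls, drop j t) else None.

Definition loop_erasure w :=
  foldr (fun d => obind (erase_dart d)) (Some ([::], [::])) w.

Variant erase_dart_spec d Ls t : seq (seq dart) -> seq dart -> Prop :=
| ErasePush of d.1 \notin edges t : erase_dart_spec d Ls t Ls (d :: t)
| ErasePop A u of t = A ++ d :: u & d.1 \notin edges A :
    erase_dart_spec d Ls t ((d :: A) :: Ls) (d :: u).

Lemma erase_dartP d Ls t Ls' t' :
  erase_dart d (Ls, t) = Some (Ls', t') -> erase_dart_spec d Ls t Ls' t'.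
Proof.
rewrite /erase_dart; case: ifP => [dt [<- <-]|/negbFE dt]; first exact: ErasePush.
case: eqP => // jd [<- <-].
have ltj : index d.1 (edges t) < size t by rewrite -(size_map fst) index_mem.
have -> : drop (index d.1 (edges t)) t = d :: drop (index d.1 (edges t)).+1 t.
  by rewrite (drop_nth d ltj) jd.
apply: ErasePop.
  by rewrite -[LHS](cat_take_drop (index d.1 (edges t))) (drop_nth d ltj) jd.
by rewrite map_take in_take_leq ?ltnn // size_map ltnW.
Qed.

Lemma erase_dart_push d Ls t :
  d.1 \notin edges t -> erase_dart d (Ls, t) = Some (Ls, d :: t).
Proof. by rewrite /erase_dart => ->. Qed.

Lemma erase_dart_pop d Ls A u : d.1 \notin edges A ->
  erase_dart d (Ls, A ++ d :: u) = Some ((d :: A) :: Ls, d :: u).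
Proof.
move=> dA; rewrite /erase_dart map_cat mem_cat /= inE eqxx orbT /=.
rewrite index_cat (negPf dA) /= eqxx addn0 size_map nth_cat ltnn subnn eqxx.
by rewrite take_size_cat // drop_size_cat.
Qed.

Lemma loop_erasure_cons d w Ls t : loop_erasure (d :: w) = Some (Ls, t) ->
  exists Ls' t', loop_erasure w = Some (Ls', t') /\
    erase_dart_spec d Ls' t' Ls t.
Proof.
rewrite /=; case: (loop_erasure w) => //= -[Ls' t'] /erase_dartP H.
by exists Ls', t'.
Qed.

Lemma loop_erasure_ind (P : seq dart -> seq (seq dart) -> seq dart -> Prop) :
  P [::] [::] [::] ->
  (forall d w Ls t, loop_erasure w = Some (Ls, t) -> P w Ls t ->
     d.1 \notin edges t -> P (d :: w) Ls (d :: t)) ->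
  (forall d w Ls A u, loop_erasure w = Some (Ls, A ++ d :: u) ->
     P w Ls (A ++ d :: u) -> d.1 \notin edges A ->
     P (d :: w) ((d :: A) :: Ls) (d :: u)) ->
  forall w Ls t, loop_erasure w = Some (Ls, t) -> P w Ls t.
Proof.
move=> P0 Ppush Ppop; elim=> [|d w IH] Ls t; first by move=> [<- <-].
move=> /loop_erasure_cons [Ls' [t' [ew]]] sp; have Pw := IH _ _ ew.
case: sp => [dt|A u tE dA]; first exact: Ppush.
by subst t'; apply: Ppop.
Qed.

Lemma loop_erasure_edge_simple w Ls t :
  loop_erasure w = Some (Ls, t) -> edge_simple t && all (@edge_simple E) Ls.
Proof.
rewrite /edge_simple; move: w Ls t.
apply: loop_erasure_ind => // [d w Ls t _ /andP[ut uLs] dt|d w Ls A u _].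
  by rewrite /= dt ut.
rewrite map_cat cat_uniq => /andP[/and3P[uA _ uu] uLs] dA.
by rewrite uu /= dA uA.
Qed.

Lemma loop_erasure_head w Ls t d0 :
  loop_erasure w = Some (Ls, t) -> head d0 t = head d0 w.
Proof. by move: w Ls t; apply: loop_erasure_ind. Qed.

Lemma loop_erasure_last w Ls t d0 :
  loop_erasure w = Some (Ls, t) -> last d0 t = last d0 w.
Proof.
move: w Ls t; apply: (loop_erasure_ind (P := fun w Ls t => last d0 t = last d0 w)) => //.
- move=> d [|c w] Ls t ew; first by case: ew => _ <-.
  have := loop_erasure_head d ew; case: t ew => [|c' t] //= ew.
  by have [Ls' [t' [_ sp]]] := loop_erasure_cons ew; inversion sp.
- move=> d w Ls A u ew; rewrite last_cat /= => ->.
  by case: w ew => [[_]|//]; case: A.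
Qed.

Lemma loop_erasure_nil w Ls : loop_erasure w = Some (Ls, [::]) -> w = [::].
Proof.
by case: w => // d w /loop_erasure_cons [Ls' [t' [_ sp]]]; inversion sp.
Qed.

Lemma loop_erasure_loops_nonempty w Ls t :
  loop_erasure w = Some (Ls, t) -> all (fun L => L != [::]) Ls.
Proof. by move: w Ls t; apply: loop_erasure_ind. Qed.

Lemma loop_erasure_count w Ls t e : loop_erasure w = Some (Ls, t) ->
  edge_count e w = edge_count e t + \sum_(L <- Ls) edge_count e L.
Proof.
move: w Ls t; apply: loop_erasure_ind => [|d w Ls t _ IH _|d w Ls A u _ IH _].
- by rewrite big_nil.
- by rewrite /= IH addnA.
rewrite big_cons /= IH /edge_count count_cat /=.
rewrite -!addnA; congr (_ + _).
by rewrite addnCA [RHS]addnCA; congr (_ + _); rewrite addnCA.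
Qed.

(** A pop cuts [d :: A ++ d :: u] at the second [d] into the cycle [d :: A] and the path [d :: u],
    so consecutive pairs are only redistributed. An arbitrary [r] covers both incidence and
    non-backtracking. *)
Lemma loop_erasure_sorted (r : rel dart) w Ls t : loop_erasure w = Some (Ls, t) ->
  sorted r w = sorted r t && all (cycle r) Ls.
Proof.
have scons d w' Ls' t' : loop_erasure w' = Some (Ls', t') ->
    sorted r w' = sorted r t' && all (cycle r) Ls' ->
    sorted r (d :: w') = sorted r (d :: t') && all (cycle r) Ls'.
  case: w' => [[<- <-] //|c w'] ew /=; have := loop_erasure_head d ew.
  case: t' ew => [/loop_erasure_nil //|c' t'] ew /= -> ->.
  by rewrite andbA.
move: w Ls t; apply: loop_erasure_ind => // [d w Ls t ew IH _|d w Ls A u ew IH _].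
  exact: scons ew IH.
rewrite (scons d _ _ _ ew IH) /= -cat_rcons cat_path last_rcons.
by rewrite [path r d u && _]andbA [path r d u && _]andbC.
Qed.

(** A cycle is a path together with the pair joining its last edge to its first, and erasure keeps
    both ends. *)
Lemma loop_erasure_cycle (r : rel dart) w Ls t : loop_erasure w = Some (Ls, t) ->
  cycle r w = cycle r t && all (cycle r) Ls.
Proof.
have cycE x p : cycle r (x :: p) = sorted r (x :: p) && r (last x (x :: p)) x.
  by rewrite /= rcons_path.
case: w => [[<- <-] //|x p] ew.
case: t ew => [/loop_erasure_nil //|y q] ew.
have yx : y = x by exact: (loop_erasure_head x ew).
subst y.
by rewrite !cycE (loop_erasure_sorted r ew) (loop_erasure_last x ew) andbAC.
Qed.

Lemma drev_neq d : d != drev d.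
Proof. by case: d => e []; rewrite xpair_eqE andbF. Qed.

Lemma edge_simple_nonbacktracking s : edge_simple s -> nonbacktracking s.
Proof.
case: s => [//|x p]; rewrite /nonbacktracking /edge_simple /= rcons_path => /andP[xp up].
apply/andP; split; last first.
  case/lastP: p xp {up} => [|p y] /=; first by rewrite drev_neq.
  rewrite last_rcons map_rcons mem_rcons inE negb_or => /andP[xy _].
  by apply: contraNneq xy => ->.
elim: p x xp up => //= y p IH x; rewrite inE negb_or => /andP[xy _] /andP[yp up].
by rewrite IH // andbT; apply: contraNneq xy => ->.
Qed.

Lemma loop_erasure_nonbacktracking w Ls t :
  loop_erasure w = Some (Ls, t) -> nonbacktracking w.
Proof.
move=> ew; have /andP[/edge_simple_nonbacktracking ut /allP uLs] := loop_erasure_edge_simple ew.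
rewrite /nonbacktracking (loop_erasure_cycle _ ew) [cycle _ _]ut.
by apply/allP => L /uLs /edge_simple_nonbacktracking.
Qed.

Definition erase_all w (o : option (seq (seq dart) * seq dart)) :=
  foldr (fun d => obind (erase_dart d)) o w.

(** Popped loops are recorded but never consulted, so success depends on the current walk alone. *)
Lemma isSome_erase_all w Ls Ls' t :
  isSome (erase_all w (Some (Ls, t))) = isSome (erase_all w (Some (Ls', t))).
Proof.
suff : omap snd (erase_all w (Some (Ls, t))) = omap snd (erase_all w (Some (Ls', t))).
  by do 2!case: erase_all.
elim: w => //= d w; case: (erase_all w _) => [[K k]|]; case: (erase_all w _) => [[H h]|] //=.
move=> [->]; case: ifP => //= _; by case: ifP.
Qed.

Lemma edge_simple_loop_erasure s : edge_simple s -> loop_erasure s = Some ([::], s).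
Proof. by rewrite /edge_simple; elim: s => //= d s IH /andP[ds /IH ->] /=; rewrite ds. Qed.

Lemma last_repeat s : ~~ edge_simple s ->
  exists p d r, [/\ s = p ++ d :: r, d.1 \in edges r & edge_simple r].
Proof.
rewrite /edge_simple; elim: s => //= d s IH; rewrite negb_and negbK.
have [us|/IH [p [c [r [-> cr ur]]]] _] := boolP (uniq (edges s)).
  by rewrite orbF => ds; exists [::], d, s.
by exists (d :: p), c, r.
Qed.

(** No edge recurs inside [r], and that of [d] recurs exactly once, so the index chosen by
    [erase_step] is where the fold meets its first repetition. *)
Lemma last_repeat_index p d r : d.1 \in edges r -> edge_simple r ->
  last 0 [seq i <- iota 0 (size (p ++ d :: r)) | occ_after (p ++ d :: r) i == 1] = size p.
Proof.
move=> dr ur; rewrite size_cat iotaD filter_cat add0n /=.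
have -> : occ_after (p ++ d :: r) (size p) == 1.
  rewrite /occ_after drop_size_cat //.
  by rewrite -(count_map fst (pred1 d.1)) count_uniq_mem // dr.
rewrite last_cat /= (eq_in_filter (a2 := pred0)) ?filter_pred0 // => i.
rewrite mem_iota => /andP[lpi lti]; rewrite /occ_after.
rewrite drop_cat ltnNge ltnW //= -(subnSK lpi) /=.
set m := i - _; have : uniq (edges (drop m r)) by rewrite map_drop drop_uniq.
case: (drop m r) => //= x r' /andP[xr' ur'].
by rewrite -(count_map fst (pred1 x.1)) count_uniq_mem // (negPf xr').
Qed.

(** One erasure step performs the first pop of the fold. Restarting on the shortened walk pushes the
    edge-simple suffix again and reaches the same current walk, with only the popped loop
    forgotten. *)
Lemma erase_okE n s : size s < n -> erase_ok n s = isSome (loop_erasure s).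
Proof.
elim: n s => // n IH s; rewrite ltnS => lsn /=; rewrite /erase_step.
case: ifP => [us|/negbT]; first by rewrite edge_simple_loop_erasure.
move=> /last_repeat [p [d [r [sE dr ur]]]].
rewrite sE last_repeat_index // drop_size_cat // take_size_cat //=.
have lE q : loop_erasure (p ++ q) = erase_all p (loop_erasure q).
  by rewrite /loop_erasure foldr_cat.
rewrite lE /= (edge_simple_loop_erasure ur) /= dr /=.
case: eqP => _; last by elim: p {sE lE} => //= c p; case: erase_all.
have ltj : index d.1 (edges r) < size r by rewrite -(size_map fst) index_mem.
rewrite IH; last first.
  rewrite (leq_trans _ lsn) // sE !size_cat size_drop /= ltn_add2l ltnS.
  exact: leq_subr.
rewrite lE (edge_simple_loop_erasure (s := drop _ r)) /edge_simple ?map_drop ?drop_uniq //.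
exact: isSome_erase_all.
Qed.

End LoopErasure.

(** * Loops: edge-simple closed walks up to rotation and reversal *)

Section Loops.
Variable E : finType.
Local Notation dart := (E * bool)%type.
Local Notation edges s := (map fst s).
Implicit Types (d : dart) (s t w L : seq dart).

Lemma drevK : involutive (@drev E).
Proof. by case=> e b; rewrite /drev /= negbK. Qed.

Lemma edges_rev_walk s : edges (rev_walk s) = rev (edges s).
Proof. by rewrite /rev_walk map_rev -map_comp. Qed.

Lemma size_rev_walk s : size (rev_walk s) = size s.
Proof. by rewrite size_rev size_map. Qed.

Lemma mem_rev_walk d s : (d \in rev_walk s) = (drev d \in s).
Proof. by rewrite mem_rev -{1}[d]drevK mem_map //; exact: inv_inj drevK. Qed.

Lemma same_loopP s t : reflect
  (exists2 i, i < size s & exists b : bool, t = rot i (if b then rev_walk s else s))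
  (same_loop s t).
Proof.
apply: (iffP hasP) => [[i]|[i lti [b ->]]]; rewrite ?mem_iota.
  by move=> /andP[_ lti] /orP[/eqP <-|/eqP <-]; exists i => //; [exists false|exists true].
by exists i; rewrite ?mem_iota //; case: b; rewrite eqxx ?orbT.
Qed.

Lemma same_loop_refl s : s != [::] -> same_loop s s.
Proof.
by move=> s0; apply/same_loopP; exists 0; [case: s s0|exists false; rewrite rot0].
Qed.

Lemma perm_edges_same_loop s t : same_loop s t -> perm_eq (edges s) (edges t).
Proof.
case/same_loopP => i _ [b ->]; rewrite map_rot perm_sym perm_rot.
by case: b; rewrite // edges_rev_walk perm_rev.
Qed.

Lemma same_loop_edge_simple s t : same_loop s t -> edge_simple s = edge_simple t.
Proof. by move/perm_edges_same_loop/perm_uniq. Qed.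

Lemma same_loop_size s t : same_loop s t -> size s = size t.
Proof. by move/perm_edges_same_loop/perm_size; rewrite !size_map. Qed.

Lemma same_loop_mem s t : same_loop s t -> edges s =i edges t.
Proof. by move/perm_edges_same_loop/perm_mem. Qed.

Lemma same_loop_loop_walk (V : finType) (ends : E -> V * V) s t :
  same_loop s t -> loop_walk ends s -> loop_walk ends t.
Proof.
move=> st /andP[/andP[s0 cs] us].
rewrite /loop_walk -(same_loop_edge_simple st) us andbT /closed_walk.
rewrite -size_eq0 -(same_loop_size st) size_eq0 s0 /=.
case/same_loopP: st => i _ [b ->]; rewrite rot_cycle; case: b => //.
rewrite /rev_walk rev_cycle cycle_map.
by apply: etrans cs; apply: eq_cycle => -[x []] [y []]; rewrite /dhead /dtail /= eq_sym.
Qed.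

Lemma edge_simple_uniq s : edge_simple s -> uniq s.
Proof. exact: map_uniq. Qed.

Lemma edge_simple_rev_walk s : edge_simple (rev_walk s) = edge_simple s.
Proof. by rewrite /edge_simple edges_rev_walk rev_uniq. Qed.

Lemma edge_simple_drev d s : edge_simple s -> d \in s -> drev d \notin s.
Proof.
rewrite /edge_simple; elim: s => //= x s IH /andP[xs us]; rewrite !inE => /orP[/eqP dx|ds].
  subst x.
  rewrite eq_sym (negPf (drev_neq d)) /=; apply: contra xs.
  exact: (@map_f _ _ fst s (drev d)).
rewrite negb_or IH // andbT; apply: contraNneq xs => <-.
by rewrite -[_.1]/(d.1) map_f.
Qed.

(** One orientation of the loop contains [d], and a rotation brings it to the front. This roots a
    piece at the directed edge that closed it. *)
Lemma same_loop_rooted s d :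
  edge_simple s -> d.1 \in edges s -> exists s', same_loop s (d :: s').
Proof.
move=> us /mapP[c cs dc].
have [b dsb] : exists b : bool, d \in (if b then rev_walk s else s).
  have [->|cd] := eqVneq d c; first by exists false.
  exists true; rewrite mem_rev_walk.
  suff -> : drev d = c by [].
  by case: d c dc cd {cs} => e [] [e' []] /= ->; rewrite ?eqxx.
have [i s' E1] := rot_to dsb; exists s'; apply/same_loopP.
(* [rot_to] does not bound [i]; a rotation by at least the length is the identity, so index 0
   replaces it. *)
have [lti|gei] := ltnP i (size s); first by exists i => //; exists b.
exists 0; first by rewrite lt0n size_eq0; apply: contraTneq cs => ->.
by exists b; rewrite rot0 -E1 rot_oversize //; case: b {dsb E1}; rewrite ?size_rev_walk.
Qed.

(** An edge-simple loop uses each edge once, so [d] fixes both the orientation and the starting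
    point. *)
Lemma same_loop_rooted_inj s d t1 t2 : edge_simple s ->
  same_loop s (d :: t1) -> same_loop s (d :: t2) -> t1 = t2.
Proof.
move=> us /same_loopP[i lti [b1 E1]] /same_loopP[j ltj [b2 E2]].
have m1 : d \in (if b1 then rev_walk s else s) by rewrite -(mem_rot i) -E1 mem_head.
have m2 : d \in (if b2 then rev_walk s else s) by rewrite -(mem_rot j) -E2 mem_head.
have b12 : b1 = b2.
  case: b1 b2 m1 m2 {E1 E2} => [] [] //; rewrite mem_rev_walk => m1 m2.
    by move: (edge_simple_drev us m2); rewrite m1.
  by move: (edge_simple_drev us m1); rewrite m2.
subst b2; set v := (if b1 then rev_walk s else s) in E1 E2.
have uv : uniq v.
  by apply: edge_simple_uniq; rewrite /v; case: (b1); rewrite ?edge_simple_rev_walk.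
have sv : size v = size s by rewrite /v; case: (b1); rewrite ?size_rev_walk.
rewrite -sv in lti ltj.
have h1 : nth d v i = d.
  by have := congr1 (head d) E1; rewrite /rot (drop_nth d lti).
have h2 : nth d v j = d.
  by have := congr1 (head d) E2; rewrite /rot (drop_nth d ltj).
have ij : i = j by apply/eqP; rewrite -(nth_uniq d lti ltj uv) h1 h2.
by move: E2; rewrite -ij -E1 => -[].
Qed.

Lemma share_edgeE s t : share_edge s t = has (mem (edges t)) (edges s).
Proof. by rewrite /share_edge has_map. Qed.

Lemma share_edge_sym s t : share_edge s t = share_edge t s.
Proof. by rewrite !share_edgeE has_sym. Qed.

Lemma share_edgeP s t :
  reflect (exists2 e, e \in edges s & e \in edges t) (share_edge s t).
Proof. by rewrite share_edgeE; apply: hasP. Qed.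

Lemma eq_share_edge s s' t t' : edges s =i edges s' -> edges t =i edges t' ->
  share_edge s t = share_edge s' t'.
Proof. by move=> es et; rewrite !share_edgeE (eq_has_r es); apply: eq_has => e /=. Qed.

End Loops.

(** * Lists of pieces attached to a base set of edges *)

Section Anchored.
Variables (E : eqType).

(** This is the list form of being a pyramid: with the edges of the top as [X] and the other pieces
    listed downwards, each piece hangs from the top or from an earlier piece. *)
Fixpoint anchored (T : Type) (f : T -> seq E) (X : seq E) (ps : seq T) : bool :=
  if ps is p :: ps' then has (mem X) (f p) && anchored f (X ++ f p) ps' else true.

Variables (T : Type) (f : T -> seq E).
Implicit Types (X Y : seq E) (ps : seq T).

Lemma anchored_sub X Y ps : {subset X <= Y} -> anchored f X ps -> anchored f Y ps.
Proof.
elim: ps X Y => //= p ps IH X Y sXY /andP[/hasP[e ep eX] aX].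
apply/andP; split; first by apply/hasP; exists e => //; apply: sXY.
by apply: IH aX => z; rewrite !mem_cat => /orP[/sXY ->|->]; rewrite ?orbT.
Qed.

Lemma anchored_cat X ps1 ps2 : anchored f X (ps1 ++ ps2) =
  anchored f X ps1 && anchored f (X ++ flatten (map f ps1)) ps2.
Proof.
elim: ps1 X => [|p ps1 IH] X /=; first by rewrite cats0.
by rewrite IH -andbA catA.
Qed.

Lemma anchored_shared X A p B : anchored f X (A ++ p :: B) ->
  has (mem (X ++ flatten (map f A))) (f p).
Proof. by rewrite anchored_cat /= => /and3P[]. Qed.

(** Putting the edges of [p] in the base enlarges what the pieces of [A] can hang from, and keeps
    everything available to those of [B]. *)
Lemma anchored_rem X A p B : anchored f X (A ++ p :: B) ->
  anchored f (X ++ f p) (A ++ B).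
Proof.
rewrite !anchored_cat /= => /and3P[aA _ aB]; apply/andP; split.
  by apply: anchored_sub aA => z; rewrite mem_cat => ->.
apply: anchored_sub aB => z; rewrite !mem_cat => /orP[/orP[]|] -> //; rewrite ?orbT //.
Qed.

Lemma anchoredP X ps :
  (forall A p B, ps = A ++ p :: B -> has (mem (X ++ flatten (map f A))) (f p)) ->
  anchored f X ps.
Proof.
elim: ps X => //= p ps IH X H; apply/andP; split.
  by have := H [::] p ps erefl; rewrite /= cats0.
apply: IH => A q B psE; have := H (p :: A) q B (congr1 (cons p) psE).
by rewrite /= catA.
Qed.

(* If the edge [e] is removed from the anchor, the only way for [ps] to come
   loose is a piece meeting the anchor in [e] alone and meeting no earlier
   piece. *)
Lemma anchored_behead e X ps : anchored f (e :: X) ps -> anchored f X ps \/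
  exists A p B, [/\ ps = A ++ p :: B, e \in f p, ~~ has (mem X) (f p) &
                    ~~ has (mem (flatten (map f A))) (f p)].
Proof.
elim: ps X => [|p ps IH] X /=; first by left.
case/andP=> sp /IH IHp.
have [sX|nX] := boolP (has (mem X) (f p)).
  case: IHp => [->|[A [q [B [-> eq nq nA]]]]]; first by left.
  right; exists (p :: A), q, B; split=> //.
    apply: contra nq => /hasP[z zq zX]; apply/hasP; exists z => //.
    by rewrite /= mem_cat; apply/orP; left.
  apply/hasPn => z zq; rewrite /= mem_cat negb_or (hasPn nA) // andbT.
  by have := hasPn nq z zq; rewrite /= mem_cat negb_or => /andP[].
right; exists [::], p, ps; split=> //; last by apply/hasPn.
case/hasP: sp => z zp; rewrite /= inE => /orP[/eqP <- //|zX].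
by case/negP: nX; apply/hasP; exists z.
Qed.

End Anchored.

Lemma anchored_eq (E : eqType) (S T : Type) (f : S -> seq E) (g : T -> seq E)
    (r : S -> T -> bool) X ps qs :
  (forall p q, r p q -> f p =i g q) -> all2 r ps qs ->
  anchored f X ps = anchored g X qs.
Proof.
move=> fg; elim: ps qs X => [|p ps IH] [|q qs] X //= /andP[/fg pq a].
rewrite (IH qs (X ++ f p) a).
congr (_ && _); first by rewrite (eq_has_r pq).
by apply/idP/idP; apply: anchored_sub => z; rewrite !mem_cat pq.
Qed.

(** A popped loop [d :: A] meets the new walk in [d]. It also heads the list, so the edges of [A],
    which leave the walk, stay available to the older loops. *)
Lemma loop_erasure_anchored (E : finType) (w : seq (E * bool)) Ls t :
  loop_erasure w = Some (Ls, t) -> anchored (map fst) (map fst t) Ls.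
Proof.
move: w Ls t; apply: loop_erasure_ind => // [d w Ls t _ IH _|d w Ls A u _ IH _].
  by apply: anchored_sub IH => z; rewrite /= inE orbC => ->.
rewrite /= mem_head /=; apply: anchored_sub IH => z.
by rewrite map_cat /= !(mem_cat, inE) => /or3P[] ->; rewrite ?orbT.
Qed.

(** * Reading a walk off a pyramid *)

Section Decode.
Variables (E : finType) (T : eqType).
Variables (lab : T -> seq (E * bool)) (ple : rel T).
Local Notation edges s := (map fst s).
Local Notation lab_edges := (fun p => edges (lab p)).
Implicit Types (d : E * bool) (t u w : seq (E * bool)) (ps : seq T).

Definition represents ps Ls := all2 (fun p L => same_loop (lab p) L) ps Ls.

(* Linear extensions are listed from the top of the heap downwards; only pairs
   of pieces that share an edge are constrained, the others being free to
   commute. *)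
Definition descending ps :=
  pairwise (fun p q => share_edge (lab p) (lab q) ==> ~~ ple p q) ps.

Hypothesis lab_simple : forall p, edge_simple (lab p).
Hypothesis share_comparable :
  forall p q, share_edge (lab p) (lab q) -> ple p q || ple q p.

Lemma descending_cat_cons A p B q :
  descending (A ++ p :: B) -> share_edge (lab p) (lab q) ->
  (q \in A -> ~~ ple q p) /\ (q \in B -> ~~ ple p q).
Proof.
rewrite /descending pairwise_cat allrel_consr.
move=> /and3P[/andP[/allP HA _] _ /= /andP[/allP HB _]] spq.
split=> [/HA|/HB] /=; last by rewrite spq.
by rewrite share_edge_sym spq.
Qed.

(** If distinct, each head would come after the other in one of the two lists, so these comparable
    pieces would be incomparable. *)
Lemma descending_head_eq p ps q qs : perm_eq (p :: ps) (q :: qs) ->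
  descending (p :: ps) -> descending (q :: qs) -> share_edge (lab p) (lab q) ->
  p = q.
Proof.
move=> pq dp dq spq; apply/eqP; apply: contraT => npq.
have qps : q \in ps.
  by have := perm_mem pq q; rewrite !inE eqxx eq_sym (negPf npq).
have pqs : p \in qs.
  by have := perm_mem pq p; rewrite !inE eqxx (negPf npq).
have [_ /(_ qps) n1] := descending_cat_cons (A := [::]) dp spq.
rewrite share_edge_sym in spq.
have [_ /(_ pqs) n2] := descending_cat_cons (A := [::]) dq spq.
by have := share_comparable spq; rewrite (negPf n1) (negPf n2).
Qed.

(* The last popped loop, if still a piece of the heap of an unfinished erasure,
   must meet the current edge-simple walk since no piece lies above it. *)
Lemma descending_head_share p ps qs w Ls t : perm_eq (p :: ps) qs ->
  descending (p :: ps) -> descending qs -> represents qs Ls ->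
  loop_erasure w = Some (Ls, t) -> share_edge (lab p) t.
Proof.
move=> pq dp dq rq /loop_erasure_anchored aL.
have aq : anchored lab_edges (edges t) qs.
  by rewrite (anchored_eq (g := map fst) _ _ rq) // => q L; apply: same_loop_mem.
have [A [B qsE]] : exists A B, qs = A ++ p :: B.
  have : p \in qs by rewrite -(perm_mem pq) mem_head.
  by case/splitPr => A B; exists A, B.
rewrite qsE in pq dq aq; have := anchored_shared aq.
case/hasP => z zp; rewrite /= mem_cat => /orP[zt|/flatten_mapP[q qA zq]].
  by apply/share_edgeP; exists z.
have spq : share_edge (lab p) (lab q) by apply/share_edgeP; exists z.
have [/(_ qA) n1 _] := descending_cat_cons dq spq.
have : q \in p :: ps by rewrite (perm_mem pq) mem_cat qA.
rewrite inE => /orP[/eqP qp|qps].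
  by move: (share_comparable spq) n1; rewrite qp orbb => ->.
have [_ /(_ qps) n2] := descending_cat_cons (A := [::]) dp spq.
by have := share_comparable spq; rewrite (negPf n1) (negPf n2).
Qed.

(** Either outcome leaves a walk starting with [d]; in this form two erasures with the same final
    walk can be compared. *)
Lemma erase_dart_specE d Ls t Ls' t' : erase_dart_spec d Ls t Ls' t' ->
  exists u, t' = d :: u /\
    ((Ls' = Ls /\ t = u) /\ d.1 \notin edges u \/
     exists A, [/\ Ls' = (d :: A) :: Ls, t = A ++ d :: u & d.1 \notin edges A]).
Proof.
case=> [dt|A u -> dA]; first by exists t; split=> //; left.
by exists u; split=> //; right; exists A.
Qed.

Lemma same_loop_share p L t : same_loop (lab p) L -> share_edge (lab p) t = share_edge L t.
Proof. by move=> /same_loop_mem pL; apply: eq_share_edge. Qed.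

Lemma pop_disjoint w Ls t d A u : loop_erasure w = Some (Ls, t) ->
  t = A ++ d :: u -> ~~ share_edge (d :: A) u.
Proof.
move=> /loop_erasure_edge_simple /andP[ut _] tE; move: ut; rewrite tE.
rewrite /edge_simple map_cat cat_uniq /= negb_or => /and3P[_ /andP[_ nA] /andP[du _]].
by rewrite share_edgeE /= negb_or du has_sym.
Qed.

(** Induction on the walk: the heap and the final walk determine whether the first edge was pushed
    or closed a loop, and which loop. *)
Lemma loop_erasure_inj w1 w2 ps1 ps2 Ls1 Ls2 t : perm_eq ps1 ps2 ->
  descending ps1 -> descending ps2 -> represents ps1 Ls1 -> represents ps2 Ls2 ->
  loop_erasure w1 = Some (Ls1, t) -> loop_erasure w2 = Some (Ls2, t) -> w1 = w2.
Proof.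
elim: w1 w2 ps1 ps2 Ls1 Ls2 t => [|d w1 IH] w2 ps1 ps2 Ls1 Ls2 t p12 d1 d2 r1 r2.
  by case=> _ <- /loop_erasure_nil.
case/loop_erasure_cons => K1 [t1 [ew1 /erase_dart_specE [u [tE H1]]]].
case: w2 => [[_ t0]|c w2]; first by rewrite tE in t0.
case/loop_erasure_cons => K2 [t2 [ew2 /erase_dart_specE [v [tE' H2]]]].
rewrite tE in tE'; case: tE' => dc uv; subst c v; congr (_ :: _).
case: H1 H2 => [[[E1 F1] n1]|[A1 [E1 F1 n1]]] [[[E2 F2] n2]|[A2 [E2 F2 n2]]].
- rewrite F1 -E1 in ew1; rewrite F2 -E2 in ew2.
  exact: (IH _ _ _ _ _ _ p12 d1 d2 r1 r2 ew1 ew2).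
(* A push cannot match a pop: the piece popped by the second walk heads a listing of the common
   heap, so it would meet the walk [u] that the first one had before its push, but it is disjoint
   from [u]. *)
- rewrite E2 in r2; case: ps2 p12 d2 r2 => // p ps2 p12 d2 /= /andP[pL r2].
  rewrite perm_sym in p12; rewrite E1 in r1.
  have := descending_head_share p12 d2 d1 r1 ew1.
  by rewrite F1 (same_loop_share _ pL) (negPf (pop_disjoint ew2 F2)).
- rewrite E1 in r1; case: ps1 p12 d1 r1 => // p ps1 p12 d1 /= /andP[pL r1].
  rewrite E2 in r2.
  have := descending_head_share p12 d1 d2 r2 ew2.
  by rewrite F2 (same_loop_share _ pL) (negPf (pop_disjoint ew1 F1)).
(* Two pops remove pieces sharing the edge of [d], hence the same piece, and its rooting at [d] is
   unique. *)
rewrite E1 in r1; case: ps1 p12 d1 r1 => // p ps1 p12 d1 /= /andP[pL r1].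
rewrite E2 in r2; case: ps2 p12 d2 r2 => // q ps2 p12 d2 /= /andP[qL r2].
have pq : p = q.
  apply: descending_head_eq p12 d1 d2 _; rewrite (same_loop_share _ pL).
  rewrite share_edge_sym (same_loop_share _ qL).
  by apply/share_edgeP; exists d.1; rewrite mem_head.
subst q; have A12 := same_loop_rooted_inj (lab_simple p) pL qL.
move: p12; rewrite perm_cons => p12.
move: d1 d2; rewrite /descending !pairwise_cons => /andP[_ d1] /andP[_ d2].
rewrite F1 in ew1; rewrite F2 -A12 in ew2.
exact: (IH _ _ _ _ _ _ p12 d1 d2 r1 r2 ew1 ew2).
Qed.

(** The decoded walk may pop commuting pieces in another order than [ps], hence the listing
    [ps']. *)
Lemma loop_erasure_surj t ps : edge_simple t ->
  anchored lab_edges (edges t) ps -> descending ps ->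
  exists w ps' Ls, [/\ loop_erasure w = Some (Ls, t), perm_eq ps' ps,
                       descending ps' & represents ps' Ls].
Proof.
(* Every step of the decoding moves one directed edge to the walk. *)
have [n] := ubnP (size t + \sum_(p <- ps) size (lab p)).
elim: n t ps => // n IH [|d u] ps.
  case: ps => [|p ps]; first by exists [::], [::], [::].
  by move=> _ _ /= /andP[/hasP[z _ /=]]; rewrite in_nil.
rewrite /= addSn ltnS => lt_n; rewrite /edge_simple /= => /andP[du uu] aps dps.
(* If [u] alone still anchors the pieces, [d] is decoded as a push. Otherwise [p] is the loop that
   [d] closed, and the walk before the pop was [s' ++ d :: u]. *)
case: (anchored_behead aps) => [au|[A [p [B [psE dp nu nA]]]]].
  have [w [ps' [Ls [ew pps' dps' rps']]]] := IH u ps lt_n uu au dps.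
  exists (d :: w), ps', Ls; split=> //.
  by rewrite /= ew; apply: erase_dart_push.
subst ps.
have [s' ps'] := same_loop_rooted (lab_simple p) dp.
have /andP[ds' us'] : (d.1 \notin edges s') && uniq (edges s').
  by rewrite -[_ && _]/(edge_simple (d :: s')) -(same_loop_edge_simple ps').
have pE := same_loop_mem ps'.
have [|||| w [qs [Ls [ew pqs dqs rqs]]]] := IH (s' ++ d :: u) (A ++ B).
- apply: leq_trans lt_n; rewrite ltnS !big_cat big_cons (same_loop_size ps') /=.
  rewrite size_cat /= !(addSn, addnS) ltnS; apply: eq_leq.
  by rewrite [X in _ = size u + X]addnCA [RHS]addnCA -addnA.
- rewrite /edge_simple map_cat cat_uniq us' /= du uu negb_or ds' /= andbT.
  apply/hasPn => z zu; apply/negP => /= zs'; case/hasP: nu; exists z => //.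
  by rewrite pE inE zs' orbT.
- apply: anchored_sub (anchored_rem aps) => z.
  rewrite map_cat /= !(mem_cat, inE) pE inE.
  by case/or4P => [|||] ->; rewrite ?orbT.
- move: dps; rewrite /descending !pairwise_cat allrel_consr /=.
  by case/and3P => /andP[_ ->] -> /andP[_ ->].
exists (d :: w), (p :: qs), ((d :: s') :: Ls); split.
- by rewrite /= ew; apply: erase_dart_pop.
- by rewrite perm_sym -cat1s perm_catCA perm_cons perm_sym.
(* [p] shares no edge with the pieces of [A], so it may be moved to the front. *)
- rewrite /descending pairwise_cons -/(descending _) dqs andbT.
  apply/allP => q; rewrite (perm_mem pqs) mem_cat => /orP[qA|qB].
    apply/implyP => /share_edgeP[z zp zq]; case/hasP: nA; exists z => //.
    by apply/flatten_mapP; exists q.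
  by apply/implyP => spq; have [_ ->] := descending_cat_cons dps spq.
by rewrite /= ps'.
Qed.

End Decode.

(** * Reachability and list auxiliaries *)

Lemma connect_homo (S T : finType) (e : rel S) (e' : rel T) (f : S -> T) :
  {homo f : x y / e x y >-> e' x y} ->
  {homo f : x y / connect e x y >-> connect e' x y}.
Proof.
move=> ef x _ /connectP[s es ->]; elim: s x es => //= y s IH x /andP[exy /IH].
exact/connect_trans/connect1/ef.
Qed.

Lemma connect_mono_bij (S T : finType) (e : rel S) (e' : rel T) (f : S -> T) :
  bijective f -> {mono f : x y / e x y >-> e' x y} ->
  {mono f : x y / connect e x y >-> connect e' x y}.
Proof.
move=> [g fK gK] ef x y; apply/idP/idP; last first.
  by apply: connect_homo => a b; rewrite ef.
have ge : {homo g : a b / e' a b >-> e a b} by move=> a b; rewrite -ef !gK.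
by move/(connect_homo ge); rewrite !fK.
Qed.

(** The path may begin with steps that stay at [x]; the first proper step is the one wanted. *)
Lemma connect_neq_step (T : finType) (e : rel T) x y :
  connect e x y -> y != x -> exists2 z, e x z & z != x.
Proof.
case/connectP => s + ->; elim: s => [|z s IH] /=; first by rewrite eqxx.
case/andP=> exz; have [->|zx _ _] := eqVneq z x; first exact: IH.
by exists z.
Qed.

Lemma all2_map2 (T S1 S2 : Type) (r : S1 -> S2 -> bool) (f : T -> S1) (g : T -> S2) s :
  all2 r (map f s) (map g s) = all (fun x => r (f x) (g x)) s.
Proof. by elim: s => //= x s ->. Qed.

Lemma all2_nth (S T : Type) (r : S -> T -> bool) x y s t i :
  all2 r s t -> i < size s -> r (nth x s i) (nth y t i).
Proof.
elim: s t i => [|a s IH] [|b t] //= [|i] /andP[rab rst] //; exact: IH.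
Qed.

Lemma pairwise_ltn_enum n : pairwise (fun i j : 'I_n => i < j) (enum 'I_n).
Proof.
have := pairwise_map val ltn (enum 'I_n); rewrite val_enum_ord => <-.
by rewrite -sorted_pairwise ?iota_ltn_sorted //; exact: ltn_trans.
Qed.

(** * The correspondence between walks and decorated pyramids *)

Section HeapOf.
Variables (V E : finType) (ends : E -> V * V).
Local Notation edges s := (map fst s).
Implicit Types (t w : seq (E * bool)) (Ls : seq (seq (E * bool))) (P : dpyr E).

(* Piece [0] is the final walk, piece [i.+1] the loop popped [i] steps before
   the last one: a smaller index means higher in the heap. *)
Definition loops_heap t Ls : dpyr E :=
  let lab (i : 'I_(size Ls).+1) := nth [::] (t :: Ls) i in
  DPyr lab (connect (fun i j : 'I_(size Ls).+1 => (j <= i) && share_edge (lab i) (lab j))) t.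

Definition walk_heap w : dpyr E :=
  let: (Ls, t) := odflt ([::], [::]) (loop_erasure w) in loops_heap t Ls.

Lemma loops_heap_le t Ls i j : ple (loops_heap t Ls) i j -> j <= i.
Proof.
case/connectP => s + ->; elim: s i => //= k s IH i /andP[/andP[ki _] /IH].
by move/leq_trans; apply.
Qed.

Lemma loops_heap_valid t Ls : loop_walk ends t -> all (loop_walk ends) Ls ->
  anchored (map fst) (edges t) Ls -> valid_dpyr ends (loops_heap t Ls).
Proof.
move=> lt lLs aL; set P := loops_heap t Ls.
have leP (i j : 'I_(pn P)) : j <= i -> share_edge (plab P i) (plab P j) -> ple P i j.
  by move=> ji sij; apply: connect1; apply/andP.
have anti p q : ple P p q -> ple P q p -> p = q.
  move=> /loops_heap_le pq /loops_heap_le qp.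
  by apply/val_inj/eqP; rewrite eqn_leq pq qp.
have top_max : maximal_piece (P := P) ord0.
  by move=> q /loops_heap_le; rewrite leqn0 => /eqP q0; apply: val_inj.
split; [|split; [|split; [|split; [|split; [|split]]]]] => //.
- move=> p; have := mem_nth [::] (ltn_ord p : p < size (t :: Ls)).
  by rewrite inE => /orP[/eqP|/(allP lLs)] // E1; rewrite [plab _ _]E1.
- by move=> p; apply: connect0.
- by move=> p q r; apply: connect_trans.
- move=> p q spq; have [qp|/ltnW pq] := leqP q p; first by rewrite leP.
  by rewrite [ple P q p]leP ?orbT // share_edge_sym.
- move=> p q; apply/idP/idP.
    by apply: (connect_homo (f := id)) => a b /andP[ba sab]; rewrite leP.
  rewrite -[ple P p q]/(connect _ p q).
  by apply: connect_sub => a b /andP[].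
exists ord0; split=> //; last by apply: same_loop_refl; case/andP: lt => /andP[].
(* A piece of index [i.+1] meets the final walk or a loop popped later. Either has a smaller index
   and lies above it, so the piece is not maximal. *)
move=> [[|i] lti] qmax; first exact: val_inj.
have lti' : i < size Ls by [].
have := aL; rewrite -[Ls in anchored _ _ Ls](cat_take_drop i) (drop_nth [::] lti').
move=> aL'; have := anchored_shared aL'; case/hasP => z zi; rewrite /= mem_cat => /orP[zt|].
  suff /qmax : ple P (Ordinal lti) ord0 by [].
  by apply: leP => //; apply/share_edgeP; exists z.
case/flatten_mapP => L /(nthP [::])[j]; rewrite size_take lti' => ltj <- zj.
have ltj' : j.+1 < (size Ls).+1 by rewrite ltnS (ltn_trans ltj).
suff /qmax/(congr1 val)[/= ji] : ple P (Ordinal lti) (Ordinal ltj').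
  by rewrite ji ltnn in ltj.
apply: leP; first by rewrite /= ltnW.
by apply/share_edgeP; exists z => //; move: zj; rewrite nth_take.
Qed.

(** Incidence passes between the walk and its parts by [loop_erasure_cycle]; non-backtracking comes
    from the edge-simplicity of the parts. *)
Lemma totally_nbP w : reflect
  (exists Ls t, [/\ loop_erasure w = Some (Ls, t), loop_walk ends t &
                    all (loop_walk ends) Ls])
  (totally_nb ends w).
Proof.
rewrite /totally_nb erase_okE //.
apply: (iffP and3P) => [[/andP[w0 cw] _]|[Ls [t [ew lt lLs]]]].
  case ew: (loop_erasure w) => [[Ls t]|] // _; exists Ls, t.
  move: cw; rewrite (loop_erasure_cycle _ ew) => /andP[ct /allP cLs].
  have /andP[ut /allP uLs] := loop_erasure_edge_simple ew.
  have /allP nLs := loop_erasure_loops_nonempty ew.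
  split=> //; rewrite /loop_walk /closed_walk ?ct ?ut ?andbT.
    by apply: contraNneq w0 => t0; rewrite t0 in ew; rewrite (loop_erasure_nil ew).
  by apply/allP => L LLs; rewrite cLs // uLs // nLs.
rewrite ew (loop_erasure_nonbacktracking ew); split=> //.
case/andP: lt => /andP[t0 ct] _; apply/andP; split.
  by apply: contraNneq t0 => w0; rewrite w0 in ew; case: ew => _ <-.
rewrite (loop_erasure_cycle _ ew) ct; apply/allP => L /(allP lLs).
by case/andP => /andP[].
Qed.

(** This rephrases isomorphism with the heap of [w] through a linear extension of [P], so that two
    walks can be compared on the same pieces. *)
Definition encodes P w := exists qs Ls,
  [/\ loop_erasure w = Some (Ls, pdeco P), perm_eq qs (enum 'I_(pn P)),
      descending (plab P) (ple P) qs & represents (plab P) qs (pdeco P :: Ls)].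

Lemma iso_encodes P w Ls t : loop_erasure w = Some (Ls, t) ->
  dpyr_iso P (loops_heap t Ls) -> encodes P w.
Proof.
move=> ew [f [[g fK gK] fle flab deco]]; exists (map g (enum 'I_(size Ls).+1)), Ls.
rewrite deco; split=> //.
- apply: uniq_perm; rewrite ?enum_uniq //.
    by rewrite map_inj_uniq ?enum_uniq //; apply: can_inj gK.
  by move=> p; rewrite mem_enum -[p]fK map_f // mem_enum.
(* Increasing indices list [loops_heap] from the top downwards. *)
- rewrite /descending pairwise_map; apply: sub_pairwise (pairwise_ltn_enum _).
  move=> i j ltij /=; apply/implyP => _; rewrite -fle !gK.
  by apply/negP => /loops_heap_le; rewrite leqNgt ltij.
rewrite /represents.
have -> : t :: Ls =
    map (fun i : 'I_(size Ls).+1 => nth [::] (t :: Ls) i) (enum 'I_(size Ls).+1).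
  rewrite (map_comp (nth [::] (t :: Ls)) val) val_enum_ord.
  by rewrite (map_nth_iota0 _ (leqnn (size (t :: Ls)))) take_size.
by rewrite all2_map2; apply/allP => i _; have := flab (g i); rewrite gK.
Qed.

(** A piece is sent to its position in [qs]. Both orders are generated by comparabilities between
    pieces sharing an edge, and positions decide those. *)
Lemma encodes_iso P w : valid_dpyr ends P -> encodes P w ->
  dpyr_iso P (walk_heap w).
Proof.
move=> [_ [lexx [_ [_ [comp [leE _]]]]]] [qs [Ls [ew qsE dqs rqs]]].
rewrite /walk_heap ew /=; set t := pdeco P in ew rqs *.
have sz : size qs = (size Ls).+1 by move: rqs; rewrite /represents all2E => /andP[/eqP].
have memq p : p \in qs by rewrite (perm_mem qsE) mem_enum.
have ltf p : index p qs < (size Ls).+1 by rewrite -sz index_mem.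
pose f p : 'I_(pn (loops_heap t Ls)) := Ordinal (ltf p).
have f_inj : injective f.
  move=> p q /(congr1 val) /= E1.
  by rewrite -(nth_index p (memq p)) E1 nth_index.
have f_bij : bijective f.
  apply: inj_card_bij => //.
  by rewrite !card_ord -[X in X <= _]sz (perm_size qsE) size_enum_ord.
have flab p : same_loop (plab P p) (plab (loops_heap t Ls) (f p)).
  have := all2_nth p [::] rqs (i := index p qs); rewrite nth_index //; apply.
  by rewrite index_mem.
exists f; split=> // p q; rewrite leE -[LHS]/(connect _ (f p) (f q)).
apply: connect_mono_bij f_bij _ p q => p q.
have sE : share_edge (plab (loops_heap t Ls) (f p)) (plab (loops_heap t Ls) (f q)) =
    share_edge (plab P p) (plab P q).
  by apply: eq_share_edge => z; apply/esym; apply: same_loop_mem.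
rewrite -[LHS]/((f q <= f p) && share_edge (plab (loops_heap t Ls) (f p)) _) sE /=.
case: (boolP (share_edge _ _)) => spq; rewrite ?andbF // !andbT.
have nle a b : share_edge (plab P a) (plab P b) -> index a qs < index b qs -> ~~ ple P a b.
  move=> sab ltab; have /(pairwiseP a) H := dqs.
  have := H (index a qs) (index b qs).
  rewrite !inE !index_mem !memq => /(_ isT isT ltab).
  by rewrite !nth_index ?memq // sab.
have [qp|pq] := leqP (index q qs) (index p qs); last by rewrite (negPf (nle _ _ spq pq)).
move: qp; rewrite leq_eqVlt => /orP[/eqP E1|qp].
  by rewrite -(nth_index p (memq q)) E1 nth_index // lexx.
rewrite share_edge_sym in spq; have := comp _ _ spq.
by rewrite (negPf (nle _ _ spq qp)) /= => ->.
Qed.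

(** Both listings begin with the piece carrying the decoration; after its removal [loop_erasure_inj]
    applies. *)
Lemma encodes_inj P w1 w2 : valid_dpyr ends P -> encodes P w1 -> encodes P w2 ->
  w1 = w2.
Proof.
move=> [lab_lw [_ [_ [_ [comp [_ [_ [_ _ deco_lw _]]]]]]]].
have us p : edge_simple (plab P p) by case/andP: (lab_lw p).
move=> [[|p ps] [Ls1 [e1 E1 d1 //]]] /= /andP[pt r1].
move=> [[|q qs] [Ls2 [e2 E2 d2 //]]] /= /andP[qt r2].
have pqE : perm_eq (p :: ps) (q :: qs) by rewrite (perm_trans E1) // perm_sym.
have pq : p = q.
  apply: (descending_head_eq comp) pqE d1 d2 _.
  rewrite (same_loop_share _ pt) share_edge_sym (same_loop_share _ qt).
  case/andP: deco_lw => /andP[+ _] _; case: (pdeco P) => // d s _.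
  by apply/share_edgeP; exists d.1; rewrite mem_head.
subst q; move: pqE; rewrite perm_cons => pqE.
move: d1 d2; rewrite /descending !pairwise_cons => /andP[_ d1] /andP[_ d2].
exact: (loop_erasure_inj us comp pqE d1 d2 r1 r2 e1 e2).
Qed.

Lemma encodes_exists P : valid_dpyr ends P ->
  exists w, totally_nb ends w /\ encodes P w.
Proof.
move=> [lab_lw [lexx [anti [trans [comp [leE [top [top_max top_uniq deco_lw top_deco]]]]]]]].
have us p : edge_simple (plab P p) by case/andP: (lab_lw p).
(* Sorting by decreasing number of pieces below gives a linear extension from the top downwards. *)
pose down p := #|[pred q | ple P q p]|.
have down_lt p q : ple P p q -> p != q -> down p < down q.
  move=> pq npq; apply: proper_card; apply/properP; split.
    by apply/subsetP => x; rewrite !inE => /trans; apply.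
  exists q; rewrite !inE ?lexx //; apply: contra npq => qp.
  by apply/eqP/anti.
pose r p q := down q <= down p.
pose ps := sort r [seq p <- enum 'I_(pn P) | p != top].
have ps_mem p : (p \in ps) = (p != top) by rewrite mem_sort mem_filter mem_enum andbT.
have ps_desc : pairwise (fun p q => ~~ ple P p q) ps.
  have : pairwise [rel p q | r p q && (p != q)] ps.
    rewrite pairwise_relI -uniq_pairwise sort_uniq filter_uniq ?enum_uniq // andbT.
    rewrite -sorted_pairwise; first by apply: sort_sorted => p q; apply: leq_total.
    by move=> q p s qp sq; apply: leq_trans sq qp.
  apply: sub_pairwise => p q /andP[rpq npq]; apply/negP => /down_lt /(_ npq).
  by rewrite ltnNge [_ <= _]rpq.
have dps : descending (plab P) (ple P) ps.
  by apply: sub_pairwise ps_desc => p q npq; rewrite npq implybT.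
(* A piece other than [top] has another piece above it; the first proper step of a generating chain
   leads to a piece sharing an edge with it, which is [top] or comes earlier in [ps]. *)
have aps : anchored (fun p => edges (plab P p)) (edges (pdeco P)) ps.
  apply: anchoredP => A p B psE.
  have np : p != top by rewrite -ps_mem psE mem_cat mem_head orbT.
  have [x pltx nxp] : exists2 x, ple P p x & x != p.
    apply/exists_inP; apply: contraNT np => /exists_inPn H.
    by apply/eqP/top_uniq => q pq; apply/eqP; rewrite -[_ == _]negbK H.
  move: pltx; rewrite leE => /connect_neq_step /(_ nxp) [y /andP[py spy] nyp].
  case/share_edgeP: spy => z zp zy; apply/hasP; exists z => //=.
  rewrite mem_cat; have [ytop|] := eqVneq y top.
    by rewrite -(same_loop_mem top_deco) -ytop zy.
  rewrite -ps_mem psE mem_cat inE (negPf nyp) /= => /orP[yA|yB].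
    by apply/orP; right; apply/flatten_mapP; exists y.
  move: ps_desc; rewrite psE pairwise_cat /= => /and3P[_ _ /andP[/allP/(_ y yB)]].
  by rewrite py.
have ud : edge_simple (pdeco P) by case/andP: deco_lw.
have [w [ps' [Ls [ew pps' dps' rps']]]] := loop_erasure_surj us ud aps dps.
exists w; split.
  apply/totally_nbP; exists Ls, (pdeco P); split=> //.
  apply/(all_nthP [::]) => i lti.
  have sz : size ps' = size Ls by move: rps'; rewrite /represents all2E => /andP[/eqP].
  rewrite -sz in lti.
  exact: same_loop_loop_walk (all2_nth top [::] rps' lti) (lab_lw _).
exists (top :: ps'), Ls; split=> //.
- apply: uniq_perm; rewrite ?enum_uniq //=.
    rewrite (perm_mem pps') ps_mem eqxx (perm_uniq pps') /=.
    by rewrite sort_uniq filter_uniq ?enum_uniq.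
  by move=> p; rewrite inE (perm_mem pps') ps_mem mem_enum orbN.
- rewrite /descending pairwise_cons -/(descending _ _ _) dps' andbT.
  apply/allP => q; rewrite (perm_mem pps') ps_mem => nq; apply/implyP => _.
  by apply: contra nq => /top_max ->.
by rewrite /= top_deco.
Qed.

Lemma walk_heap_valid w : totally_nb ends w -> valid_dpyr ends (walk_heap w).
Proof.
case/totally_nbP => Ls [t [ew lt lLs]]; rewrite /walk_heap ew.
by apply: loops_heap_valid => //; apply: loop_erasure_anchored ew.
Qed.

Lemma encodes_of_iso P w : totally_nb ends w -> dpyr_iso P (walk_heap w) -> encodes P w.
Proof.
by case/totally_nbP => Ls [t [ew _ _]]; rewrite /walk_heap ew; apply: iso_encodes.
Qed.

Lemma dpyr_iso_refl P : valid_dpyr ends P -> dpyr_iso P P.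
Proof.
move=> [lab_lw _]; exists id; split=> //; first by exists id.
by move=> p; apply: same_loop_refl; case/andP: (lab_lw p) => /andP[].
Qed.

Lemma walk_heap_count w e : totally_nb ends w ->
  edge_count e w = \sum_(p < pn (walk_heap w)) edge_count e (plab (walk_heap w) p).
Proof.
case/totally_nbP => Ls [t [ew _ _]]; rewrite /walk_heap ew /=.
transitivity (\sum_(L <- t :: Ls) edge_count e L).
  by rewrite big_cons (loop_erasure_count e ew).
by rewrite (big_nth [::]) big_mkord.
Qed.

End HeapOf.

Theorem mainTheorem15 (V E : finType) (ends : E -> V * V) :
  exists Phi : seq (E * bool) -> dpyr E,
    (forall w, totally_nb ends w -> valid_dpyr ends (Phi w)) /\
    (forall w1 w2, totally_nb ends w1 -> totally_nb ends w2 ->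
       dpyr_iso (Phi w1) (Phi w2) -> w1 = w2) /\
    (forall P, valid_dpyr ends P -> exists w, totally_nb ends w /\ dpyr_iso P (Phi w)) /\
    (forall w, totally_nb ends w -> forall e : E,
       edge_count e w = \sum_(p < pn (Phi w)) edge_count e (plab (Phi w) p)).
Proof.
exists (@walk_heap E); split; [|split; [|split]].
- exact: walk_heap_valid.
(* Both walks encode the heap of [w1]. *)
- move=> w1 w2 nb1 nb2 iso12; have v1 := walk_heap_valid nb1.
  apply: (encodes_inj v1); last exact: encodes_of_iso nb2 iso12.
  exact: encodes_of_iso nb1 (dpyr_iso_refl v1).
- move=> P vP; have [w [nbw ew]] := encodes_exists vP.
  by exists w; split=> //; apply: encodes_iso vP ew.
by move=> w nbw e; apply: walk_heap_count nbw.
Qed.
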